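(* Let $B(2d-1,d)$ be the bipartite graph with vertex set $\{x\subseteq[2d-1]:|x|\in\{d-1,d\}\}$ in which $x,y$ are adjacent iff $x\subsetneq y$. Let $\mathcal{I}$ be the set of maximal independent sets of $B(2d-1,d)$ and \[ \mathcal{J}_1=\left\{I\in\mathcal{I}: |M(I)|>\left(1-\frac{2\log^3 d}{d}\right)\binom{2d-2}{d-1}\right\}. \] Then, as $d\to\infty$, \[ |\mathcal{I}\setminus\mathcal{J}_1|=2^{\left(1-\Omega\left(\frac{\log^3 d}{d}\right)\right)\binom{2d-2}{d-1}}=o(|\mathcal{I}|). \]
   Context: $\log$ denotes $\log_2$. An induced matching in a graph $G$ is a set $M$ of pairwise disjoint edges such that for distinct $xy,uv\in M$ none of $xu,xv,yu,yv$ is an edge. For an independent set $I$ of $G=B(2d-1,d)$, $M(I)$ denotes an induced matching of maximum size among those induced matchings $M$ such that every edge $xy\in M$ satisfies $|\{x,y\}\cap I|=1$ and every $v\in I\setminus V(M)$ has no neighbor in $V(M)$ (ties broken by a fixed ordering; the empty matching is allowed). Only $|M(I)|$ matters here. *)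

(* Defs.v *)
From HB Require Import structures.
From mathcomp Require Import all_boot all_order all_algebra.
From mathcomp Require Import all_classical all_reals all_analysis.

Set Implicit Arguments.
Unset Strict Implicit.
Unset Printing Implicit Defensive.

Import Order.TTheory GRing.Theory Num.Theory.
Import numFieldNormedType.Exports.

Local Open Scope nat_scope.

Definition independent (T : finType) (e : rel T) (I : {set T}) : bool :=
  [forall x in I, forall y in I, ~~ e x y].

Definition maximal_independent_sets (T : finType) (e : rel T) : {set {set T}} :=
  [set I : {set T} | maxset (independent e) I]%SET.

Definition is_edge (T : finType) (e : rel T) (m : {set T}) : bool :=
  [exists x, exists y, e x y && (m == [set x; y]%SET)].

Definition induced_matching (T : finType) (e : rel T) (M : {set {set T}}) : bool :=
  [&& [forall m in M, is_edge e m],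
      finset.trivIset M
    & [forall m in M, forall m' in M, (m != m') ==>
        [forall x in m, forall u in m', ~~ e x u]]].

(* [finset.cover M] is the set V(M) of the endpoints of the edges in M. *)
Definition compatible_matching (T : finType) (e : rel T)
    (I : {set T}) (M : {set {set T}}) : bool :=
  [&& induced_matching e M,
      [forall m in M, #|(m :&: I)%SET| == 1]
    & [forall v in (I :\: finset.cover M)%SET,
        forall w in finset.cover M, ~~ e v w]].

(* The default [finset.set0] is itself compatible with I, so this is a true
   maximizer; ties are broken by the fixed enumeration of {set {set T}}. *)
Definition max_compatible_matching (T : finType) (e : rel T)
    (I : {set T}) : {set {set T}} :=
  [arg max_(M > finset.set0 | compatible_matching e I M) #|M|].

Definition Bvertex (d : nat) : finType :=
  {x : {set 'I_(2 * d - 1)} | (#|x| == d - 1) || (#|x| == d)}.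

Definition Badj (d : nat) : rel (Bvertex d) :=
  fun x y => (val x \proper val y) || (val y \proper val x).

Definition Bmis (d : nat) : {set {set Bvertex d}} :=
  maximal_independent_sets (@Badj d).

Local Open Scope ring_scope.

Definition log2 {R : realType} (x : R) : R := ln x / ln 2.

Definition J1 (R : realType) (d : nat) : {set {set Bvertex d}} :=
  [set I in Bmis d |
    (1 - 2 * log2 (d%:R : R) ^+ 3 / d%:R) * 'C(2 * d - 2, d - 1)%:R
      < #|max_compatible_matching (@Badj d) I|%:R]%SET.

(* One-sided (signed) lower bound, as needed for an exponent 1 - Omega(f): the
   library's Omega bounds `|g| from below and would allow g to be negative. *)
Definition is_Omega (R : realType) (g f : nat -> R) : Prop :=
  exists2 c : R, 0 < c & \forall d \near \oo%classic, c * f d <= g d.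

(* Main.v *)
(* Weight a maximal independent set I of an induced subgraph G[W] by b^|M(I)|
   with b = 49/50, M(I) being computed inside W; let wt W be the total weight.
   Deciding whether a vertex v lies in I gives
   wt W <= wt (W \ v) + wt (W \ N[v]), and Hujter-Tuza branching on
   triangle-free graphs then yields wt W <= (7/5)^|W|: the value 2 b = (7/5)^2
   is attained by K_2, and everything else loses a constant factor.
   Let now G be d-regular on 2N vertices.  If |W| = N + x, double counting the
   edges leaving W gives a vertex of degree at least d x / N in G[W]; branching
   on it until |W| <= N costs only a factor exp(O(N log^2 d / d)) over
   (7/5)^N.  Since N <= 2m with m = 'C(2d-2, d-1), at most
   2^m b^(delta m) exp(O(m log^2 d / d)) sets I have |M(I)| <= (1 - delta) m,
   and delta = 2 log^3 d / d beats the error term.  On the other hand a maximum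
   induced matching has 2^m transversals, which extend to distinct maximal
   independent sets. *)
Require Import Defs.
From mathcomp Require Import all_boot all_order all_algebra.
From mathcomp Require Import ring lra zify.
From mathcomp Require Import reals sequences exp.

Set Implicit Arguments.
Unset Strict Implicit.
Unset Printing Implicit Defensive.

Import Order.TTheory GRing.Theory Num.Theory.

(** * Sums compared along an injection *)

Lemma ler_sum_inj (R : numDomainType) (I J : finType) (P : pred I) (Q : pred J)
    (F : I -> R) (G : J -> R) (h : I -> J) :
  {in P &, injective h} -> (forall i, P i -> Q (h i)) ->
  (forall i, P i -> F i <= G (h i))%R -> (forall j, 0 <= G j)%R ->
  (\sum_(i | P i) F i <= \sum_(j | Q j) G j)%R.
Proof.
move=> hinj PQ FG G0; apply: le_trans (ler_sum _ FG) _.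
rewrite -(big_imset G hinj) [leRHS](bigID (mem (h @: P))) /=.
rewrite [X in (_ <= X + _)%R](eq_bigl (mem (h @: P))) ?lerDl ?sumr_ge0 // => j.
by rewrite andb_idl // => /imsetP [i Pi ->]; apply: PQ.
Qed.

(** * Maximal independent sets and matchings inside an induced subgraph *)

Section WeightedCount.

Variables (T : finType) (e : rel T) (R : realFieldType).
Hypothesis e_sym : symmetric e.
Hypothesis e_tri : forall x y z, e x y -> e y z -> ~~ e x z.

Implicit Types (W I : {set T}) (M : {set {set T}}).

Definition nbrs v : {set T} := [set u | e v u].

Definition cnbrs v : {set T} := v |: nbrs v.

(** Maximality in the subgraph induced by [W] is encoded as domination, which can be checked vertex
    by vertex after deletions. *)
Definition mis_in W I : bool :=
  [&& I \subset W, independent e I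
    & [forall v in W :\: I, exists u in I, e v u]].

(* The size of [M(I)] when only edges of the subgraph induced by [W] are allowed. *)
Definition nu W I : nat :=
  \max_(M | compatible_matching e I M && (cover M \subset W)) #|M|.

(** A loop is a degenerate triangle. *)
Lemma e_irr x : e x x = false.
Proof. by apply/negP => exx; have := e_tri exx exx; rewrite exx. Qed.

Lemma independentP I :
  reflect {in I &, forall x y, ~~ e x y} (independent e I).
Proof.
apply: (iffP forall_inP) => [H x y xI yI | H x xI].
  by move/forall_inP: (H x xI); apply.
by apply/forall_inP => y yI; apply: H.
Qed.

Lemma mis_inP W I :
  reflect [/\ {subset I <= W}, {in I &, forall x y, ~~ e x y}
    & forall v, v \in W -> v \notin I -> exists2 u, u \in I & e v u]
    (mis_in W I).
Proof.
apply: (iffP and3P) => [[/subsetP H1 /independentP H2 H3] | [H1 H2 H3]].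
  split=> // v vW vI; move/forall_inP: H3 => /(_ v).
  by rewrite inE vI vW => /(_ isT) /exists_inP [u uI evu]; exists u.
split; [exact/subsetP | exact/independentP |].
apply/forall_inP => v; rewrite inE => /andP [vI vW].
by have [u uI evu] := H3 v vW vI; apply/exists_inP; exists u.
Qed.

Lemma maximal_mis_in I : I \in maximal_independent_sets e -> mis_in setT I.
Proof.
rewrite inE => /maxsetP [/independentP indI maxI].
apply/mis_inP; split=> // v _ vI.
have [/exists_inP // | /exists_inPn far] := boolP [exists u in I, e v u].
case/negP: (vI).
rewrite -(maxI (v |: I)) ?setU11 ?subsetUr //; apply/independentP => x y.
move=> /setU1P [-> | xI] /setU1P [-> | yI].
- by rewrite e_irr.
- exact: far.
- by rewrite e_sym far.
exact: indI.
Qed.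

Lemma compatibleP I M :
  reflect [/\ forall m, m \in M -> exists x y, e x y /\ m = [set x; y],
     trivIset M,
     forall m m' x u, m \in M -> m' \in M -> m != m' ->
       x \in m -> u \in m' -> ~~ e x u,
     forall m, m \in M -> #|m :&: I| = 1
   & forall v w, v \in I -> v \notin cover M -> w \in cover M -> ~~ e v w]
   (compatible_matching e I M).
Proof.
apply: (iffP and3P) => [[/and3P [H1 H2 H3] H4 H5] | [H1 H2 H3 H4 H5]].
  split=> //.
  - move=> m mM; move/forall_inP: H1 => /(_ m mM).
    by case/existsP => x /existsP [y /andP [exy /eqP ->]]; exists x, y.
  - move=> m m' x u mM m'M neq xm um'.
    move/forall_inP: H3 => /(_ m mM) /forall_inP /(_ m' m'M) /implyP /(_ neq).
    by move/forall_inP => /(_ x xm) /forall_inP; apply.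
  - by move=> m mM; move/forall_inP: H4 => /(_ m mM) /eqP.
  move=> v w vI vM wM; move/forall_inP: H5 => /(_ v).
  by rewrite inE vM vI => /(_ isT) /forall_inP; apply.
split.
- apply/and3P; split=> //.
    apply/forall_inP => m /H1 [x [y [exy ->]]].
    by apply/existsP; exists x; apply/existsP; exists y; rewrite exy eqxx.
  apply/forall_inP => m mM; apply/forall_inP => m' m'M; apply/implyP => neq.
  by apply/forall_inP => x xm; apply/forall_inP => u; apply: H3 xm.
- by apply/forall_inP => m /H4 ->.
apply/forall_inP => v; rewrite inE => /andP [vM vI].
by apply/forall_inP => w; apply: H5.
Qed.

Lemma compatible0 I : compatible_matching e I set0.
Proof.
apply/compatibleP; split=> [m||m m' x u|m|v w _ _]; rewrite ?inE //.
  by rewrite /trivIset /cover !big_set0 cards0.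
by rewrite /cover big_set0 inE.
Qed.

Lemma leq_nu W I M :
  compatible_matching e I M -> cover M \subset W -> #|M| <= nu W I.
Proof.
by move=> cM sM; apply: (@leq_bigmax_cond _ _ (fun M => #|M|)); rewrite cM.
Qed.

Lemma nu_attained W I :
  exists2 M, compatible_matching e I M && (cover M \subset W) & nu W I = #|M|.
Proof.
pose P M := compatible_matching e I M && (cover M \subset W).
have P0 : P set0 by rewrite /P compatible0 /cover big_set0 sub0set.
have : 0 < #|P| by apply/card_gt0P; exists set0.
by move=> /(eq_bigmax_cond (fun M => #|M|)) [M PM nuE]; exists M.
Qed.

Lemma nu_setT I : nu setT I = #|max_compatible_matching e I|.
Proof.
rewrite /max_compatible_matching; case: arg_maxnP => [|M cM Mmax].
  exact: compatible0.
apply/eqP; rewrite eqn_leq leq_nu ?subsetT // andbT.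
by have [M' /andP [cM' _] ->] := nu_attained setT I; apply: Mmax.
Qed.

Lemma nuS W W' I : W' \subset W -> nu W' I <= nu W I.
Proof.
move=> sW; have [M /andP [cM sM] ->] := nu_attained W' I.
by apply: leq_nu => //; apply: subset_trans sW.
Qed.

Lemma mis_in_out W I v : mis_in W I -> v \notin I -> mis_in (W :\ v) I.
Proof.
case/mis_inP => sIW indI maxI vI; apply/mis_inP; split=> //.
  by move=> x xI; rewrite !inE sIW // andbT; apply: contraNneq vI => <-.
by move=> u; rewrite !inE => /andP [_]; apply: maxI.
Qed.

Lemma mis_in_in W I v : mis_in W I -> v \in I ->
  mis_in (W :\: cnbrs v) (I :\ v).
Proof.
case/mis_inP => sIW indI maxI vI; apply/mis_inP; split.
- move=> x; rewrite !inE => /andP [xv xI].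
  by rewrite (negPf xv) (negPf (indI v x vI xI)) /= sIW.
- by move=> x y; rewrite !inE => /andP [_ xI] /andP [_ yI]; apply: indI.
move=> u; rewrite !inE negb_or => /andP [/andP [uv nvu] uW].
rewrite uv /= => uI; have [w wI euw] := maxI u uW uI.
exists w => //; rewrite !inE wI andbT.
by apply: contraNneq nvu => <-; rewrite e_sym.
Qed.

(** [V(M)] avoids the closed neighbourhood of [v], so putting [v] back neither meets an edge of [M]
    nor gives [V(M)] a new neighbour in [I]. *)
Lemma compatible_in W I M v : v \in I -> cover M \subset W :\: cnbrs v ->
  compatible_matching e (I :\ v) M -> compatible_matching e I M.
Proof.
move=> vI /subsetP sM /compatibleP [H1 H2 H3 H4 H5].
apply/compatibleP; split=> //.
  move=> m mM; rewrite -(H4 m mM); congr #|pred_of_set _|.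
  apply/setP => x; rewrite !inE; case xm: (x \in m) => //=.
  have : x \in cover M by apply/bigcupP; exists m.
  by move/sM; rewrite !inE negb_or => /andP [/andP [-> _] _].
move=> u w uI uM wM; have [->|neq] := eqVneq u v.
  by have := sM w wM; rewrite !inE negb_or => /andP [/andP [_ ->]].
by apply: H5 => //; rewrite !inE neq.
Qed.

Lemma nu_in W I v : v \in I -> nu (W :\: cnbrs v) (I :\ v) <= nu W I.
Proof.
move=> vI; have [M /andP [cM sM] ->] := nu_attained (W :\: cnbrs v) (I :\ v).
apply: leq_nu; first exact: compatible_in sM cM.
exact: subset_trans sM (subsetDl _ _).
Qed.

(** Here [vw] is a whole component of the subgraph on [W] with exactly [v] in [I], so it extends any
    matching found in the rest. Strictness is what lets the weight profit from b < 1. *)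
Lemma nu_in_edge W I v w : mis_in W I -> v \in I -> w \in W ->
  nbrs v :&: W = [set w] -> nbrs w :&: W = [set v] ->
  nu (W :\: cnbrs v) (I :\ v) < nu W I.
Proof.
move=> misI vI wW Nv Nw; case/mis_inP: (misI) => sIW indI maxI.
have [M /andP [cM sM] ->] := nu_attained (W :\: cnbrs v) (I :\ v).
have /compatibleP [H1 H2 H3 H4 H5] := compatible_in vI sM cM.
have evw : e v w by have := set11 w; rewrite -Nv !inE => /andP [].
have ewv : e w v by rewrite e_sym.
have wI : w \notin I by apply/negP => /(indI v w vI); rewrite evw.
have nv u : u \in W -> e v u -> u = w.
  by move=> uW evu; apply/set1P; rewrite -Nv !inE evu.
have nw u : u \in W -> e w u -> u = v.
  by move=> uW ewu; apply/set1P; rewrite -Nw !inE ewu.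
have sMW x : x \in cover M -> [/\ x \in W, x != v & x != w].
  move/(subsetP sM); rewrite !inE negb_or => /andP [/andP [xv nvx] xW].
  by split=> //; apply: contraNneq nvx => ->.
have inM m x : m \in M -> x \in m -> x \in cover M.
  by move=> mM xm; apply/bigcupP; exists m.
have vwM m : m \in M -> [disjoint [set v; w] & m].
  move=> mM; apply/pred0P => x /=; apply/negbTE/negP => /andP [].
  by rewrite !inE => /orP [] /eqP -> /(inM _ _ mM) /sMW []; rewrite eqxx.
have new : [set v; w] \notin M.
  apply/negP => /vwM; rewrite -setI_eq0 setIid => /eqP/setP/(_ v).
  by rewrite !inE eqxx.
have cov : cover ([set v; w] |: M) = [set v; w] :|: cover M.
  by rewrite /cover big_setU1.
have far x u : x \in [set v; w] -> u \in cover M -> ~~ e x u.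
  move=> xvw /sMW [uW uv uw]; apply/negP.
  by move: xvw; rewrite !inE => /orP [] /eqP -> => [/nv|/nw] => /(_ uW) uE;
    rewrite uE eqxx in uv uw.
have -> : #|M|.+1 = #|[set v; w] |: M| by rewrite cardsU1 new.
apply: leq_nu; last first.
  rewrite cov subUset; apply/andP; split.
    by apply/subsetP => x; rewrite !inE => /orP [] /eqP -> //; apply: sIW.
  exact: subset_trans sM (subsetDl _ _).
apply/compatibleP; split.
- by move=> m /setU1P [-> | /H1 //]; exists v, w.
- have n0 : set0 \notin M.
    by apply/negP => /H1 [x [y [_ /setP /(_ x)]]]; rewrite !inE eqxx.
  by case: (trivIsetU1 (fun m mM => vwM m mM) H2 n0).
- move=> m m' x u /setU1P [-> | mM] /setU1P [-> | m'M] neq xm um'.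
  + by rewrite eqxx in neq.
  + exact: far xm (inM _ _ m'M um').
  + by rewrite e_sym; exact: far um' (inM _ _ mM xm).
  + exact: H3 xm um'.
- move=> m /setU1P [-> | /H4 //]; apply/eqP/cards1P; exists v.
  apply/setP => x; rewrite !inE; have [-> | xv] := eqVneq x v.
    by rewrite vI.
  by have [-> | //] := eqVneq x w; rewrite (negPf wI).
move=> x y xI; rewrite cov !inE !negb_or => /andP [/andP [xv xw] xM].
case/orP => [/orP [] /eqP -> | yM]; last exact: H5.
  exact: indI.
by apply/negP; rewrite e_sym => /(nw x (sIW x xI)) xE; rewrite xE eqxx in xv.
Qed.

(** * The weight of an induced subgraph and its branching inequalities *)

Local Open Scope ring_scope.

(* With base b = 49/50 and growth rate g = 7/5, the extremal component K_2 is
   tight, [2 b = g ^ 2], and all the branchings below lose a constant factor. *)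
Definition wt W : R := \sum_(I | mis_in W I) (49 / 50) ^+ nu W I.

Lemma ler_wt_exp (m n : nat) : (m <= n)%N ->
  (49 / 50 : R) ^+ n <= (49 / 50) ^+ m.
Proof. by move=> mn; apply: ler_wiXn2l => //; lra. Qed.

Lemma setD1_injective v (I J : {set T}) : v \in I -> v \in J -> I :\ v = J :\ v -> I = J.
Proof.
by move=> vI vJ IJ; rewrite -(setD1K vI) IJ setD1K.
Qed.

(** Removing [v] is injective on the sets containing it and cannot raise the matching number, so no
    weight drops, the base being below 1. *)
Lemma wt_in W v :
  \sum_(I | mis_in W I && (v \in I)) (49 / 50) ^+ nu W I <= wt (W :\: cnbrs v).
Proof.
apply: (@ler_sum_inj _ _ _ _ _ _ _ (fun I => I :\ v)).
- by move=> I J /andP [_ vI] /andP [_ vJ]; apply: setD1_injective.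
- by move=> I /andP [misI vI]; apply: mis_in_in.
- by move=> I /andP [_ vI]; apply/ler_wt_exp/nu_in.
by move=> I; apply: exprn_ge0; lra.
Qed.

Lemma wt_in_edge W v w : w \in W ->
  nbrs v :&: W = [set w] -> nbrs w :&: W = [set v] ->
  \sum_(I | mis_in W I && (v \in I)) (49 / 50) ^+ nu W I
    <= 49 / 50 * wt (W :\: cnbrs v).
Proof.
move=> wW Nv Nw; rewrite mulr_sumr.
apply: (@ler_sum_inj _ _ _ _ _ _ _ (fun I => I :\ v)).
- by move=> I J /andP [_ vI] /andP [_ vJ]; apply: setD1_injective.
- by move=> I /andP [misI vI]; apply: mis_in_in.
- by move=> I /andP [misI vI]; rewrite -exprS; apply/ler_wt_exp/(nu_in_edge (w := w)).
by move=> I; apply: mulr_ge0; [lra | apply: exprn_ge0; lra].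
Qed.

(** A set avoiding [v] remains dominating once [v] is deleted; the sets containing [v] go to the
    second term. *)
Lemma wt_branch W v : wt W <= wt (W :\ v) + wt (W :\: cnbrs v).
Proof.
rewrite /wt (bigID (fun I => v \in I)) /= addrC; apply: lerD (wt_in W v).
apply: (@ler_sum_inj _ _ _ _ _ _ _ id) => //.
- by move=> I /andP [misI vI]; apply: mis_in_out.
- by move=> I _; apply/ler_wt_exp/nuS/subsetDl.
by move=> I; apply: exprn_ge0; lra.
Qed.

Lemma wt_isolated W v : v \in W -> nbrs v :&: W = set0 ->
  wt W <= wt (W :\: cnbrs v).
Proof.
move=> vW Nv; apply: le_trans (wt_in W v).
rewrite /wt le_eqVlt; apply/orP; left; apply/eqP/eq_bigl => I.
rewrite andb_idr // => /mis_inP [sIW _ maxI]; apply/negPn/negP => vI.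
have [u uI evu] := maxI v vW vI.
by have := in_set0 u; rewrite -Nv !inE evu sIW.
Qed.

Lemma mis_pendant W I v w : v \in W -> nbrs v :&: W = [set w] ->
  mis_in W I -> v \notin I -> w \in I.
Proof.
move=> vW Nv /mis_inP [sIW _ maxI] vI; have [u uI evu] := maxI v vW vI.
by have : u \in [set w]; [rewrite -Nv !inE evu sIW | move=> /set1P <-].
Qed.

(** Only [w] can dominate [v], so every set counted contains [v] or [w]. *)
Lemma wt_pendant_split W v w : v \in W -> nbrs v :&: W = [set w] ->
  wt W <= \sum_(I | mis_in W I && (v \in I)) (49 / 50) ^+ nu W I
        + \sum_(I | mis_in W I && (w \in I)) (49 / 50) ^+ nu W I.
Proof.
move=> vW Nv; rewrite /wt (bigID (fun I => v \in I)) /= lerD2l.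
apply: (@ler_sum_inj _ _ _ _ _ _ _ id) => //.
  by move=> I /andP [misI vI]; rewrite misI; apply: mis_pendant misI vI.
by move=> I; apply: exprn_ge0; lra.
Qed.

Lemma wt_pendant W v w : v \in W -> nbrs v :&: W = [set w] ->
  wt W <= wt (W :\: cnbrs v) + wt (W :\: cnbrs w).
Proof.
by move=> vW Nv; apply: le_trans (wt_pendant_split vW Nv) (lerD _ _); apply: wt_in.
Qed.

Lemma wt_edge W v w : v \in W -> w \in W ->
  nbrs v :&: W = [set w] -> nbrs w :&: W = [set v] ->
  wt W <= 49 / 50 * wt (W :\: cnbrs v) + 49 / 50 * wt (W :\: cnbrs w).
Proof.
move=> vW wW Nv Nw; apply: le_trans (wt_pendant_split vW Nv) _.
exact: lerD (wt_in_edge wW Nv Nw) (wt_in_edge vW Nw Nv).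
Qed.

(** * The bound on the weight of a triangle-free graph *)

Lemma card_setD_cnbrs W v : v \in W ->
  (#|W :\: cnbrs v| + #|nbrs v :&: W|).+1 = #|W|.
Proof.
move=> vW; rewrite -(cardsID (cnbrs v) W).
have -> : W :&: cnbrs v = v |: (nbrs v :&: W).
  by rewrite setIC setIUl (setIidPl _) // sub1set.
by rewrite cardsU1 !inE e_irr; lia.
Qed.

Lemma wt_le W : wt W <= (7 / 5) ^+ #|W|.
Proof.
have [n nW] := ubnP #|W|; elim: n W nW => // n IHn W nW.
have IH W' k : (0 < k)%N -> (#|W'| + k <= #|W|)%N ->
    wt W' <= (7 / 5) ^+ (#|W| - k).
  move=> k0 W'k; apply: le_trans (IHn W' _) _; first by lia.
  by apply: ler_weXn2l; [lra | lia].
have cW v : v \in W -> (#|W :\: cnbrs v| + #|nbrs v :&: W|).+1 = #|W|.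
  exact: card_setD_cnbrs.
have exp_split k : (k <= #|W|)%N ->
    (7 / 5) ^+ #|W| = (7 / 5) ^+ (#|W| - k) * (7 / 5 : R) ^+ k.
  by move=> kW; rewrite -exprD subnK.
have g0 k : 0 < (7 / 5 : R) ^+ k by apply: exprn_gt0; lra.
have [W0|[v vW]] := set_0Vmem W.
  rewrite W0 cards0 expr0 /wt.
  have mis0 I : mis_in set0 I -> I == set0 by case/and3P; rewrite subset0.
  apply: le_trans (_ : \sum_(I | I == set0) 1 <= 1); last by rewrite big_pred1_eq.
  apply: (@ler_sum_inj _ _ _ _ _ _ _ id) => // I _.
  by apply: exprn_ile1; lra.
(* Degree at least 3: the branches lose 1 and at least 4 vertices, and g^3 + 1 = 3.744 < 3.8416 =
   g^4. *)
have [/existsP [u /andP [uW du]] | /existsPn deg_le2] :=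
    boolP [exists u, (u \in W) && (2 < #|nbrs u :&: W|)%N].
  have := wt_branch W u; have := cW u uW; have := cardsD1 u W; rewrite uW => c1 c2.
  have := IH (W :\ u) 1 isT; have := IH (W :\: cnbrs u) 4 isT.
  have -> : (#|W| - 1 = #|W| - 4 + 3)%N by lia.
  rewrite (exp_split 4) ?exprD; last by lia.
  move=> /(_ ltac:(lia)) H1 /(_ ltac:(lia)) H2 H3.
  have := g0 (#|W| - 4)%N; set X := (7 / 5) ^+ _ in H1 H2 *.
  by lra.
have [/existsP [u /andP [uW du]] | /existsPn deg_ge1] :=
    boolP [exists u, (u \in W) && (#|nbrs u :&: W| == 0)%N].
  have := cW u uW; have := wt_isolated uW; move: du; rewrite cards_eq0 => /eqP du.
  move=> /(_ du) H1 c1; have := IH (W :\: cnbrs u) 1 isT.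
  rewrite (exp_split 1); last by lia.
  move=> /(_ ltac:(lia)) H2.
  have := g0 (#|W| - 1)%N; set X := (7 / 5) ^+ _ in H2 *.
  by lra.
have [/existsP [u /andP [uW du]] | /existsPn deg_ge2] :=
    boolP [exists u, (u \in W) && (#|nbrs u :&: W| == 1)%N].
  have cu := cW u uW; have [w Nu] := cards1P du.
  have /setIP [] : w \in nbrs u :&: W by rewrite Nu set11.
  rewrite inE => euw wW; have cw := cW w wW.
  have uNw : u \in nbrs w :&: W by rewrite !inE e_sym euw.
  (* A component K_2: both branches lose 2 vertices and carry the factor 49/50, and 2 * 49/50 = g^2
     exactly. *)
  have [dw | dw] := eqVneq #|nbrs w :&: W| 1%N.
    have Nw : nbrs w :&: W = [set u].
      by have /eqP/cards1P [x Nw] := dw; move: uNw; rewrite Nw => /set1P ->.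
    have := wt_edge uW wW Nu Nw; have := IH (W :\: cnbrs u) 2%N isT.
    have := IH (W :\: cnbrs w) 2%N isT.
    rewrite (exp_split 2%N); last by lia.
    move=> /(_ ltac:(lia)) H1 /(_ ltac:(lia)) H2 H3.
    have := g0 (#|W| - 2)%N; set X := (7 / 5) ^+ _ in H1 H2 *.
    by lra.
  (* A pendant vertex whose neighbour has degree at least 2: g + 1 = 2.4 < 2.744 = g^3. *)
  have dw2 : (1 < #|nbrs w :&: W|)%N.
    by have : (0 < #|nbrs w :&: W|)%N; [apply/card_gt0P; exists u | lia].
  have := wt_pendant uW Nu; have := IH (W :\: cnbrs u) 2%N isT.
  have := IH (W :\: cnbrs w) 3%N isT.
  have -> : (#|W| - 2 = #|W| - 3 + 1)%N by lia.
  rewrite (exp_split 3%N) ?exprD; last by lia.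
  move=> /(_ ltac:(lia)) H1 /(_ ltac:(lia)) H2 H3.
  have := g0 (#|W| - 3)%N; set X := (7 / 5) ^+ _ in H1 H2 *.
  by lra.
have deg2 u : u \in W -> #|nbrs u :&: W| = 2%N.
  by move=> uW; have := deg_le2 u; have := deg_ge1 u; have := deg_ge2 u; rewrite uW; lia.
(* Deleting [u] makes its neighbour [v] pendant, attached to [w]; as the graph
   is triangle-free, [w] keeps its two neighbours. *)
have /eqP/cards2P [u [w [uw Nv]]] := deg2 v vW.
have /setIP [] : u \in nbrs v :&: W by rewrite Nv !inE eqxx.
rewrite inE => evu uW.
have /setIP [] : w \in nbrs v :&: W by rewrite Nv !inE eqxx orbT.
rewrite inE => evw wW.
have vu : v != u by apply: contraTneq evu => ->; rewrite e_irr.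
have vU : v \in W :\ u by rewrite !inE vu.
have wU : w \in W :\ u by rewrite !inE eq_sym uw.
have nuw : ~~ e w u by apply: e_tri evu; rewrite e_sym.
have NvU : nbrs v :&: (W :\ u) = [set w].
  rewrite setIDA Nv; apply/setP => x; rewrite !inE.
  by have [-> | //] := eqVneq x u; rewrite (negPf uw).
have NwU : nbrs w :&: (W :\ u) = nbrs w :&: W.
  apply/setP => x; rewrite !inE.
  by have [-> | //] := eqVneq x u; rewrite (negPf nuw).
have := cardsD1 u W; rewrite uW => cW'.
have := cW u uW; have := card_setD_cnbrs vU; have := card_setD_cnbrs wU.
rewrite NwU NvU !deg2 // cards1 => cw cv cu.
have [n4 su sv sw] : [/\ #|W| = (#|W| - 4 + 4)%N,
    #|W :\: cnbrs u| + 3 <= #|W|, #|W :\ u :\: cnbrs v| + 3 <= #|W|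
  & #|W :\ u :\: cnbrs w| + 4 <= #|W|]%N.
  by move: cW' cu cv cw; clear; split; lia.
have H3 : (#|W| - 3 = #|W| - 4 + 1)%N by move: n4; clear; lia.
have := IH _ 3%N isT su; have := IH _ 3%N isT sv; have := IH _ 4%N isT sw.
rewrite H3 [in X in _ -> _ -> _ -> X]n4 !exprD => {H3} H1 H2 H3.
(* Three branches, losing 3, 3 and 4 vertices: 2g + 1 = 3.8 < 3.8416 = g^4. *)
have := wt_branch W u; have := wt_pendant vU NvU => H4 H5.
have := g0 (#|W| - 4)%N; set X := (7 / 5) ^+ _ in H1 H2 H3 *.
by lra.
Qed.

End WeightedCount.

(** * Degrees inside large vertex sets of a regular graph *)

Section RegularGraph.

Variables (T : finType) (e : rel T) (d N : nat).
Hypothesis e_sym : symmetric e.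
Hypothesis e_regular : forall v, #|nbrs e v| = d.
Hypothesis cardT : #|T| = 2 * N.

(** At most d(2N - |W|) edges leave [W], so the degrees inside [W] sum to at least 2d(|W| - N), and
    |W| <= 2N bounds their average from below. *)
Lemma large_set_degree (W : {set T}) : N < #|W| ->
  exists2 v, v \in W & d * (#|W| - N) <= #|nbrs e v :&: W| * N.
Proof.
move=> NW.
have [/exists_inP [v vW dv] | /exists_inPn small] :=
  boolP [exists v in W, d * (#|W| - N) <= #|nbrs e v :&: W| * N].
  by exists v.
have S1 : \sum_(v in W) #|nbrs e v :&: W| + \sum_(v in W) #|nbrs e v :\: W|
    = #|W| * d.
  rewrite -big_split -sum_nat_const; apply: eq_bigr => v _ /=.
  by rewrite cardsID e_regular.
have S2 : \sum_(v in W) #|nbrs e v :\: W| = \sum_(u in ~: W) #|nbrs e u :&: W|.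
  transitivity (\sum_(v in W) \sum_(u in ~: W) e v u).
    apply: eq_bigr => v _; rewrite -sum1dep_card big_mkcond [RHS]big_mkcond /=.
    by apply: eq_bigr => u _; rewrite !inE; case: (u \in W); case: (e v u).
  rewrite exchange_big; apply: eq_bigr => u _.
  rewrite -sum1dep_card big_mkcond [RHS]big_mkcond /=.
  by apply: eq_bigr => v _; rewrite !inE e_sym; case: (v \in W); case: (e u v).
have S3 : \sum_(u in ~: W) #|nbrs e u :&: W| <= (2 * N - #|W|) * d.
  have -> : 2 * N - #|W| = #|~: W| by rewrite [RHS]cardsCs setCK cardT.
  rewrite -sum_nat_const; apply: leq_sum => u _.
  by rewrite -(e_regular u) subset_leq_card // subsetIl.
have S4 : (\sum_(v in W) #|nbrs e v :&: W|) * N + #|W| <= #|W| * (d * (#|W| - N)).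
  rewrite big_distrl /= -[X in _ + X]sum1_card -big_split -sum_nat_const /=.
  by apply: leq_sum => v /small; rewrite addn1 -ltnNge.
have nT : #|W| <= 2 * N by rewrite -cardT max_card.
move: S1 S3 S4 NW nT; rewrite S2; clear.
move: (\sum_(v in W) _) (\sum_(u in ~: W) _) #|W| => s s' n H1 H2 H3 Nn n2.
have [x nE] : exists x, n = N + x by exists (n - N); lia.
have [y NE] : exists y, N = x + y by exists (N - x); lia.
have -> : n - N = x by lia.
suff : 2 * (d * x) <= s by nia.
have : 2 * N - n = y by lia.
nia.
Qed.

End RegularGraph.

(** * Many maximal independent sets from an induced matching *)

Lemma card_maximal_independent_ge (T : finType) (e : rel T) (A : {set T})
    (phi : T -> T) :
  symmetric e ->
  {in A &, forall x y, ~~ e x y} ->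
  {in A &, forall x y, ~~ e (phi x) (phi y)} ->
  {in A &, forall x y, e x (phi y) = (x == y)} ->
  2 ^ #|A| <= #|maximal_independent_sets e|.
Proof.
move=> e_sym indA indphi ephi.
(* The hypotheses make the pairs [x], [phi x] an induced matching; [base S] is its transversal
   taking [x] on [S] and [phi x] on the rest of [A]. *)
pose base (S : {set T}) := S :|: phi @: (A :\: S).
have base_ind (S : {set T}) : S \subset A -> independent e (base S).
  move=> /subsetP sA; apply/independentP => x y.
  have mix u v : u \in S -> v \in A :\: S -> ~~ e u (phi v).
    move=> uS /setDP [vA vS]; rewrite ephi ?(sA u) //.
    by apply: contraNneq vS => <-.
  move=> /setUP [xS | /imsetP [x' x'A ->]] /setUP [yS | /imsetP [y' y'A ->]].
  - by apply: indA; apply: sA.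
  - exact: mix.
  - by rewrite e_sym mix.
  by apply: indphi; [case/setDP: x'A | case/setDP: y'A].
(* For [S] inside [A] the default [set0] is never taken, as [base S] extends to a maximal
   independent set. *)
pose h S := odflt set0 [pick J | maxset (independent e) J && (base S \subset J)].
have hP (S : {set T}) : S \subset A -> maxset (independent e) (h S) && (base S \subset h S).
  move=> sA; rewrite /h; case: pickP => //= noJ.
  by have [J mJ sJ] := maxset_exists (base_ind S sA); have := noJ J; rewrite mJ sJ.
(* [S] can be read off [h S]: for [x] in [A] outside [S], the neighbour [phi x] already lies in
   [h S]. *)
have hA (S : {set T}) : S \subset A -> h S :&: A = S.
  move=> sA; have /andP [/maxsetp /independentP indh /subsetP sh] := hP S sA.
  apply/setP => x; rewrite inE; apply/andP/idP => [[xh xA] | xS]; last first.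
    by split; [apply: sh; rewrite inE xS | apply: (subsetP sA)].
  apply/negPn/negP => xS.
  have phixh : phi x \in h S by apply: sh; rewrite inE imset_f ?orbT // inE xS.
  by have := indh x (phi x) xh phixh; rewrite ephi // eqxx.
rewrite -card_powerset -(@card_in_imset _ _ h).
  apply: subset_leq_card; apply/subsetP => J /imsetP [S]; rewrite inE => sA ->.
  by rewrite inE; case/andP: (hP S sA).
by move=> S S'; rewrite !inE => /hA hS /hA hS' hh; rewrite -hS hh hS'.
Qed.

(** * The graph of the two middle layers *)

Section MiddleLayers.

Variable d : nat.
Hypothesis d_gt0 : 0 < d.

Implicit Types x y z : Bvertex d.

Local Notation e := (@Badj d).
Local Notation m := 'C(2 * d - 2, d - 1).

Lemma Badj_sym : symmetric e.
Proof. by move=> x y; rewrite /Badj orbC. Qed.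

Lemma card_Bvertex_val x : #|val x| = d - 1 \/ #|val x| = d.
Proof. by case: x => A /= /orP [] /eqP; [left | right]. Qed.

Lemma Badj_layer x y : e x y -> (#|val x| == d) = ~~ (#|val y| == d).
Proof.
have := card_Bvertex_val x; have := card_Bvertex_val y.
by move: d_gt0 => d0 hy hx /orP [] /proper_card; move: d0 hx hy; clear;
  move: #|val x| #|val y| => a b; lia.
Qed.

(** Edges switch layers, which is impossible around an odd cycle. *)
Lemma Badj_tri x y z : e x y -> e y z -> ~~ e x z.
Proof.
move=> /Badj_layer xy /Badj_layer yz; apply/negP => /Badj_layer.
by rewrite xy yz; case: (_ == d).
Qed.

Lemma card_Bvertex : #|Bvertex d| = 2 * 'C(2 * d - 1, d).
Proof.
rewrite card_sig.
transitivity #|[set A : {set 'I_(2 * d - 1)} | #|A| == d - 1]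
               :|: [set A : {set 'I_(2 * d - 1)} | #|A| == d]|.
  by apply: eq_card => A; rewrite !inE.
rewrite cardsU (_ : _ :&: _ = set0) ?cards0 ?subn0; last first.
  by apply/setP => A; rewrite !inE; move: d_gt0; clear; lia.
rewrite !card_draws card_ord -bin_sub; last by move: d_gt0; clear; lia.
have -> : 2 * d - 1 - (d - 1) = d by move: d_gt0; clear; lia.
by rewrite addnn -mul2n.
Qed.

Lemma proper_cover (U : finType) (A B : {set U}) : A \subset B ->
  #|B| = #|A|.+1 -> exists2 i, i \notin A & B = i |: A.
Proof.
move=> sAB cB; have /eqP/cards1P [i iE] : #|B :\: A| = 1.
  by have := cardsID A B; rewrite (setIidPr sAB) cB; lia.
have /setDP [iB iA] : i \in B :\: A by rewrite iE set11.
exists i => //; apply/eqP; rewrite eq_sym eqEcard cB cardsU1 iA leqnn andbT.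
by rewrite subUset sub1set iB.
Qed.

(** A (d-1)-set has 2d-1-(d-1) = d one-element extensions, and a d-set has d one-element
    deletions. *)
Lemma Badj_regular x : #|nbrs e x| = d.
Proof.
rewrite -(card_imset _ val_inj); have [cx | cx] := card_Bvertex_val x.
  transitivity #|[set i |: val x | i in ~: val x]|.
    congr #|pred_of_set _|; apply/setP => B; apply/imsetP/imsetP.
      case=> y; rewrite inE => exy ->.
      have := Badj_layer exy; have := card_Bvertex_val y.
      rewrite cx => cy lay; have {}cy : #|val y| = (d - 1).+1.
        by move: d_gt0 cy lay; clear; lia.
      case/orP: exy => [/proper_sub sxy | /proper_card]; last by rewrite cy cx ltnNge leqnSn.
      have [i ix yE] := proper_cover sxy (etrans cy (congr1 S (esym cx))).
      by exists i; rewrite ?inE.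
    case=> i; rewrite inE => ix ->.
    have cB : (#|i |: val x| == d - 1) || (#|i |: val x| == d).
      by rewrite cardsU1 ix cx; move: d_gt0; clear; lia.
    exists (exist _ (i |: val x) cB) => //.
    rewrite inE /Badj /= properE subsetUr /=; apply/orP; left.
    by apply/negP => /subsetP/(_ i); rewrite !inE eqxx (negPf ix) => /(_ isT).
  rewrite card_in_imset; last first.
    move=> i j; rewrite !inE => ix jx /setP/(_ i).
    by rewrite !inE eqxx (negPf ix) /= orbF => /esym /eqP.
  by rewrite cardsCs setCK card_ord cx; move: d_gt0; clear; lia.
transitivity #|[set val x :\ i | i in val x]|.
  congr #|pred_of_set _|; apply/setP => B; apply/imsetP/imsetP.
    case=> y; rewrite inE => exy ->.
    have := Badj_layer exy; have := card_Bvertex_val y.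
    rewrite cx eqxx => cy lay; have {}cy : #|val x| = #|val y|.+1.
      by rewrite cx; move: d_gt0 cy lay; clear; lia.
    case/orP: exy => [/proper_card | /proper_sub syx]; first by rewrite cy ltnNge leqnSn.
    have [i iy xE] := proper_cover syx cy.
    by exists i; rewrite xE ?setU1K // !inE eqxx.
  case=> i ix ->.
  have cB : (#|val x :\ i| == d - 1) || (#|val x :\ i| == d).
    by have := cardsD1 i (val x); rewrite ix cx; move: d_gt0; clear; lia.
  exists (exist _ (val x :\ i) cB) => //.
  rewrite inE /Badj /= [X in _ || X]properE subsetDl /=; apply/orP; right.
  by apply/negP => /subsetP/(_ i ix); rewrite !inE eqxx.
rewrite card_in_imset //.
move=> i j ix jx /setP/(_ i); rewrite !inE eqxx /= => /esym/negbT.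
by rewrite negb_and ix orbF negbK => /eqP.
Qed.

(** The matching joins each (d-1)-set avoiding [i0] to its union with [i0]. It has m edges, and it
    is induced since an inclusion of [x] in [i0 |: y] forces x = y. *)
Lemma card_Bmis_ge : 2 ^ m <= #|Bmis d|.
Proof.
have n_gt0 : 0 < 2 * d - 1 by move: d_gt0; clear; lia.
pose i0 := Ordinal n_gt0.
pose A := [set x : Bvertex d | (#|val x| == d - 1) && (i0 \notin val x)].
(* On [A] the union has [d] elements, so [insubd] does not fall back on its default [x] there. *)
pose phi x : Bvertex d := insubd x (i0 |: val x).
have AP x : x \in A -> #|val x| = d - 1 /\ i0 \notin val x.
  by rewrite inE => /andP [/eqP].
have phiE x : x \in A -> val (phi x) = i0 |: val x.
  case/AP => cx ix; rewrite val_insubd cardsU1 ix cx.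
  by case: ifP => // /negbT; move: d_gt0; clear; lia.
have lowE x : x \in A -> (#|val x| == d) = false.
  by case/AP => -> _; move: d_gt0; clear; lia.
have highE x : x \in A -> (#|val (phi x)| == d) = true.
  move=> xA; rewrite phiE // cardsU1; have [-> ->] := AP x xA.
  by move: d_gt0; clear; lia.
have -> : m = #|A|.
  rewrite -(card_imset _ val_inj) /=.
  have <- : #|~: [set i0]| = 2 * d - 2.
    by rewrite cardsCs setCK card_ord cards1; move: d_gt0; clear; lia.
  rewrite -cards_draws; congr #|pred_of_set _|; apply/setP => B.
  rewrite !inE subsetC sub1set inE; apply/andP/imsetP => [[iB cB] | [x /AP [cx ix] ->]].
    have cB' : (#|B| == d - 1) || (#|B| == d) by rewrite cB.
    by exists (exist _ B cB') => //; rewrite inE cB iB.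
  by rewrite cx eqxx.
apply: (@card_maximal_independent_ge _ _ A phi Badj_sym) => x y xA yA.
- by apply/negP => /Badj_layer; rewrite !lowE.
- by apply/negP => /Badj_layer; rewrite !highE.
have [cx ix] := AP x xA; have [cy iy] := AP y yA.
rewrite /Badj phiE //; apply/orP/eqP => [[/proper_sub /subsetP sxy | /proper_card] | ->].
- apply/val_inj/eqP; rewrite eqEcard cx cy leqnn andbT; apply/subsetP => i iX.
  by have := sxy i iX; rewrite !inE => /predU1P [iE | //]; rewrite -iE iX in ix.
- by rewrite cardsU1 iy cx cy; clear; lia.
left; rewrite properE subsetUr; apply/negP => /subsetP/(_ i0).
by rewrite !inE eqxx (negPf iy) => /(_ isT).
Qed.

(** One side of the bipartition; it witnesses that [Bmis d :\: J1 R d] is nonempty, as writing its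
    size as a power of 2 requires. *)
Definition low_layer : {set Bvertex d} := [set x : Bvertex d | #|val x| != d].

Lemma low_layer_Bmis : low_layer \in Bmis d.
Proof.
rewrite inE; apply/maxsetP; split.
  apply/independentP => x y; rewrite !inE => xd yd; apply/negP => /Badj_layer.
  by rewrite (negPf xd) (negPf yd).
move=> B /independentP indB sB; apply/eqP; rewrite eqEsubset sB andbT.
apply/subsetP => y yB; rewrite inE; apply/negP => yd.
have /card_gt0P [x] : 0 < #|nbrs e y| by rewrite Badj_regular.
rewrite inE => eyx; have := Badj_layer eyx; rewrite yd => /esym xd.
have xB : x \in B by apply: (subsetP sB); rewrite inE.
by have := indB y x yB xB; rewrite eyx.
Qed.

(** The upper end of a matching edge has a second lower neighbour [z], as d > 1. If uncovered, [z]
    violates compatibility; if covered, the matching is not induced. *)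
Lemma low_layer_matching : 1 < d ->
  max_compatible_matching e low_layer = set0.
Proof.
move=> d1; rewrite /max_compatible_matching; case: arg_maxnP.
  exact: compatible0.
move=> M /compatibleP [H1 _ H3 _ H5] _; apply/eqP/set0Pn => -[mm mM].
have [u [l [eul mE ud]]] : exists u l, [/\ e u l, mm = [set u; l] & #|val u| == d].
  have [a [b [eab ->]]] := H1 mm mM; have [ad | ad] := boolP (#|val a| == d).
    by exists a, b.
  exists b, a; rewrite Badj_sym setUC; split=> //.
  by have := Badj_layer eab; rewrite (negPf ad) => /esym/negbFE.
have /card_gt0P [z] : 0 < #|nbrs e u :\ l|.
  have := cardsD1 l (nbrs e u); rewrite Badj_regular inE eul; move: d1; clear.
  by lia.
rewrite !inE => /andP [zl euz].
have zlow : z \in low_layer.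
  by have := Badj_layer euz; rewrite ud inE => /esym.
have uM : u \in cover M by apply/bigcupP; exists mm => //; rewrite mE !inE eqxx.
have [/bigcupP [m' m'M zm'] | zM] := boolP (z \in cover M); last first.
  by have := H5 z u zlow zM uM; rewrite Badj_sym euz.
have [mm' | neq] := eqVneq mm m'.
  move: zm'; rewrite -mm' mE !inE (negPf zl) orbF => /eqP zu.
  by have := Badj_layer euz; rewrite zu; case: (_ == d).
have um : u \in mm by rewrite mE !inE eqxx.
by have := H3 mm m' u z mM m'M neq um zm'; rewrite euz.
Qed.

(** Dividing by [d] gives N <= 2m for the layer size N. *)
Lemma mul_bin_middle : d * 'C(2 * d - 1, d) = (2 * d - 1) * m.
Proof.
have -> : 2 * d - 2 = (2 * d - 1).-1 by move: d_gt0; clear; lia.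
by rewrite mul_bin_diag (_ : (d - 1).+1 = d) // subn1 prednK.
Qed.

Lemma leq_bin_middle : d <= m.
Proof.
case: d d_gt0 => // k _; have -> : 2 * k.+1 - 2 = k.*2 by lia.
rewrite subn1 /=; elim: k => // k IHk; rewrite doubleS !binS.
by have := leq_bin2l k (leqnSn k.*2); move: IHk; clear; lia.
Qed.

End MiddleLayers.

(** * The growth factor for large vertex sets *)

Section Growth.

Local Open Scope ring_scope.

Variables (R : realType) (A l : R).
Hypotheses (A_gt0 : 0 < A) (l_ge0 : 0 <= l).

(** The solution of g'/g = 2l / (1 + x/A) with value 1 at 0. With A = N/d, [x / A] is the degree
    guaranteed when |W| = N + x. *)
Definition growth (x : R) : R := expR (2 * l * A * ln (1 + x / A)).

(** The inequality ln(1 + t) <= t, with t = (x' - x)/(A + x), bounds the logarithm by its tangent at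
    [x]. *)
Lemma growth_le (D x x' : R) : 0 <= x' -> x' <= x - D -> 0 <= D ->
  growth x' <= growth x * expR (- (2 * l * (D / (1 + x / A)))).
Proof.
move=> x'0 xx' D0; have A_pos := A_gt0; have x0 : 0 <= x by lra.
have y0 : 0 < 1 + x / A by rewrite ltr_wpDr // divr_ge0 // ltW.
have y'0 : 0 < 1 + x' / A by rewrite ltr_wpDr // divr_ge0 // ltW.
rewrite /growth -expRD ler_expR.
have A0 : A != 0 by rewrite gt_eqF.
have Ax : 0 < A + x by lra.
have Ax0 : A + x != 0 by rewrite gt_eqF.
have yE : 1 + x / A = (A + x) / A by field.
have lnE : ln (1 + x' / A) <= ln (1 + x / A) - D / (A + x).
  have -> : 1 + x' / A = (1 + x / A) * (1 + (x' - x) / (A + x)).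
    by field; rewrite A0 Ax0.
  rewrite lnM ?posrE //; last first.
    by rewrite -(pmulr_rgt0 _ Ax) mulrDr mulrCA divff //; lra.
  rewrite lerD2l; apply: le_trans (le_ln1Dx _) _.
    by rewrite -(ltr_pM2r Ax) mulrVK ?unitfE //; lra.
  by rewrite -mulNr ler_pM2r ?invr_gt0 //; lra.
have -> : D / (1 + x / A) = A * (D / (A + x)) by rewrite yE; field; rewrite A0 Ax0.
have lA : 0 <= 2 * l * A by rewrite !mulr_ge0 // ltW.
have := ler_wpM2l lA lnE; rewrite mulrBr !mulrA; lra.
Qed.

Lemma growth_ge1 x : 0 <= x -> 1 <= growth x.
Proof.
move=> x0; rewrite /growth -[leLHS]expR0 ler_expR mulr_ge0 //.
  by rewrite !mulr_ge0 // ltW.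
by rewrite ln_ge0 // lerDl divr_ge0 // ltW.
Qed.

End Growth.

(** * The weight of a regular triangle-free graph *)

Section RegularTriangleFree.

Local Open Scope ring_scope.

Variables (T : finType) (e : rel T) (R : realType) (d N : nat).
Hypothesis e_sym : symmetric e.
Hypothesis e_tri : forall x y z, e x y -> e y z -> ~~ e x z.
Hypothesis e_regular : forall v, #|nbrs e v| = d.
Hypothesis cardT : #|T| = (2 * N)%N.
Hypotheses (d_gt0 : (0 < d)%N) (dN : (d <= N)%N).

Local Notation A := (N%:R / d%:R : R).
Local Notation l := (ln (d.+1%:R) : R).
Hypothesis l_ge1 : 1 <= l.

(** The terms are the loss factors of deleting a vertex and of deleting its closed neighbourhood. By
    exp(-u) <= 1/(1 + u) it suffices that u >= 1/d, which holds as l >= 1 and d >= 1. *)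
Lemma branching_sum_le1 :
  expR (- (2 * l / d.+1%:R)) + expR (- l) <= 1.
Proof.
have l1 := l_ge1; have d1 : 1 <= d%:R :> R by rewrite ler1n.
have -> : expR (- l) = d.+1%:R^-1 by rewrite expRN lnK // posrE ltr0n.
set u := 2 * l / _.
have d0 : 0 < d.+1%:R :> R by rewrite ltr0n.
have uE : u * d.+1%:R = 2 * l by rewrite /u mulrVK // unitfE gt_eqF.
have u0 : 0 < u by rewrite divr_gt0 //; lra.
have u1 : 0 < 1 + u by lra.
have : expR (- u) <= (1 + u)^-1.
  by rewrite expRN lef_pV2 ?posrE ?expR_gt0 ?expR_ge1Dx.
suff H : (1 + u)^-1 + d.+1%:R^-1 <= 1.
  by move=> H'; apply: le_trans H; rewrite lerD2r.
have -> : (1 + u)^-1 + d.+1%:R^-1 = (d.+1%:R + 1 + u) / ((1 + u) * d.+1%:R).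
  rewrite -[(1 + u)^-1]div1r -[d.+1%:R^-1]div1r addf_div ?gt_eqF //.
  by rewrite !mul1r addrA.
rewrite ler_pdivrMr ?mulr_gt0 //.
have uD : u * d.+1%:R = u * d%:R + u by rewrite -natr1 mulrDr mulr1.
rewrite mul1r mulrDl mul1r uD; rewrite uD in uE.
have : u <= u * d%:R by rewrite ler_peMr // ltW.
by lra.
Qed.

(* [|W| = N + x] forces a vertex of degree at least [x / A], and then both
   branches shrink the bound enough by [growth_le]. *)
Lemma wt_growth (W : {set T}) :
  wt e R W <= (7 / 5) ^+ N * growth A l (#|W| - N)%:R.
Proof.
have N0 : (0 < N)%N by apply: leq_trans dN.
have [n nW] := ubnP #|W|; elim: n W nW => // n IHn W nW.
have d0 : 0 < d%:R :> R by rewrite ltr0n.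
have N0' : 0 < N%:R :> R by rewrite ltr0n.
have A0 : 0 < A by rewrite divr_gt0.
have l1 := l_ge1; have l0 : 0 <= l by lra.
have g0 : 0 < (7 / 5 : R) ^+ N by apply: exprn_gt0; lra.
have [WN | NW] := leqP #|W| N.
  apply: le_trans (wt_le R e_sym e_tri W) _.
  apply: (@le_trans _ _ ((7 / 5) ^+ N)); first by apply: ler_weXn2l => //; lra.
  by rewrite ler_peMr ?(ltW g0) // growth_ge1.
have [v vW dv] := large_set_degree e_sym e_regular cardT NW.
have cv := card_setD_cnbrs e_tri vW; have := cardsD1 v W; rewrite vW => cW.
have Wmax : (#|W| <= 2 * N)%N by rewrite -cardT max_card.
apply: le_trans (wt_branch R e_sym W v) _.
have IH1 := IHn (W :\ v) ltac:(move: nW cW; clear; lia).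
have IH2 := IHn (W :\: cnbrs e v) ltac:(move: nW cv; clear; lia).
set x : R := (#|W| - N)%:R.
have x1 : 1 <= x by rewrite ler1n subn_gt0.
have xN : x <= N%:R by rewrite ler_nat; move: Wmax; clear; lia.
have xA : x / A <= x.
  rewrite ler_pdivrMr // ler_peMr //.
  by rewrite ler_pdivlMr // mul1r ler_nat.
have xA0 : 0 <= x / A by rewrite divr_ge0 // ltW.
have xAd : x / A <= d%:R.
  by rewrite ler_pdivrMr // mulrC mulrVK ?unitfE ?gt_eqF.
(* Deleting [v] lowers [x] by 1, and x/A <= d keeps the rate at least 2l/(d + 1). *)
have E1 : growth A l (#|W :\ v| - N)%:R <=
    growth A l x * expR (- (2 * l / d.+1%:R)).
  have xE : (#|W :\ v| - N)%:R = x - 1.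
    have -> : x = (#|W :\ v| - N)%:R + 1.
      by rewrite natr1; congr (_ %:R); move: cW NW; clear; lia.
    by rewrite addrK.
  apply: le_trans (growth_le A0 l0 (D := 1) (x := x) _ _ _) _ => //.
    by rewrite xE.
  rewrite ler_pM2l ?expR_gt0 // ler_expR lerN2 mul1r ler_wpM2l //; first by lra.
  by rewrite lef_pV2 ?posrE ?ltr0n // -?natr1; lra.
have E2 : growth A l (#|W :\: cnbrs e v| - N)%:R <= growth A l x * expR (- l).
  have y0 : 1 + x / A != 0 by rewrite gt_eqF // ltr_wpDr.
  (* The drop is taken as D = (1 + x/A)/2, which gives exactly exp(-l). Half of the full loss is
     used because [x] may be truncated at 0, where only x >= (1 + x/A)/2 is available; hence the 2
     in [growth]. *)
  have half (z : R) : z != 0 -> l = 2 * l * (z / 2 / z) by move=> z0; field.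
  rewrite [X in expR (- X)](half _ y0).
  apply: growth_le => //; last by lra.
  have [small | big] := leqP #|W :\: cnbrs e v| N.
    by move: small; rewrite -subn_eq0 => /eqP ->; lra.
  have dv' : x / A <= #|nbrs e v :&: W|%:R.
    rewrite invf_div mulrA ler_pdivrMr // -!natrM ler_nat.
    by move: dv; clear; lia.
  have -> : (#|W :\: cnbrs e v| - N)%:R = x - 1 - #|nbrs e v :&: W|%:R.
    have -> : x = (#|W :\: cnbrs e v| - N)%:R + 1 + #|nbrs e v :&: W|%:R.
      by rewrite natr1 -natrD; congr (_ %:R); move: cv big; clear; lia.
    by ring.
  by lra.
apply: le_trans (lerD IH1 IH2) _.
rewrite -mulrDr ler_pM2l //; apply: le_trans (lerD E1 E2) _.
by rewrite -mulrDr ler_piMr ?expR_ge0 // branching_sum_le1.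
Qed.

(** For the whole vertex set x = N, so 1 + x/A = d + 1 and the logarithm in [growth] equals [l]. *)
Lemma wt_setT_le :
  wt e R [set: T] <= (7 / 5) ^+ N * expR (2 * l ^+ 2 * (N%:R / d%:R)).
Proof.
have d0 : d%:R != 0 :> R by rewrite pnatr_eq0 -lt0n.
have N0 : N%:R != 0 :> R by rewrite pnatr_eq0 -lt0n (leq_trans d_gt0).
apply: le_trans (wt_growth _) _; rewrite cardsT cardT mul2n -addnn addnK /growth.
have -> : N%:R / A = d%:R by field; rewrite d0 N0.
by rewrite nat1r -mulrA [A * _]mulrC mulrA expr2 mulrA.
Qed.

End RegularTriangleFree.

(** * Counting the sets with a small matching *)

Section Counting.

Local Open Scope ring_scope.

Variables (R : realType) (d : nat).
Hypothesis d_gt0 : (0 < d)%N.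

Local Notation m := 'C(2 * d - 2, d - 1).
Local Notation h := (log2 (d%:R : R) ^+ 3 / d%:R).
Local Notation beta := (- ln (49 / 50 : R)).

(** Each set counted has matching number at most (1 - 2h)m, hence weight at least b^((1 - 2h)m), so
    the total weight bounds their number. *)
Lemma small_matching_le : 1 <= ln (d.+1%:R : R) ->
  #|Bmis d :\: J1 R d|%:R
    <= expR (m%:R * (ln 2 - beta * (2 * h) + 4 * ln (d.+1%:R : R) ^+ 2 / d%:R)).
Proof.
move=> l_ge1; set S := Bmis d :\: J1 R d; set N := 'C(2 * d - 1, d).
have d0 : 0 < d%:R :> R by rewrite ltr0n.
have dN := mul_bin_middle d_gt0; have dm := leq_bin_middle d_gt0.
have N2 : (N <= 2 * m)%N.
  by rewrite -(leq_pmul2l d_gt0) dN; move: d_gt0; clear; nia.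
have dleN : (d <= N)%N.
  rewrite -(leq_pmul2l d_gt0) dN; move: d_gt0 dm; move: m; clear; nia.
have b0 : 0 < 49 / 50 :> R by lra.
have powE k : (49 / 50 : R) ^+ k = expR (- (beta * k%:R)).
  by rewrite mulNr opprK mulr_natr -lnXn // lnK // posrE exprn_gt0.
have lower : #|S|%:R * expR (- (beta * ((1 - 2 * h) * m%:R)))
    <= wt (@Badj d) R [set: Bvertex d].
  rewrite mulr_natl -sumr_const.
  apply: (@ler_sum_inj _ _ _ _ _ _ _ id) => //.
  - by move=> I; rewrite inE => /andP [_ /(maximal_mis_in (@Badj_sym d) (Badj_tri d_gt0))].
  - move=> I; rewrite inE => /andP [notJ misI]; move: notJ.
    rewrite inE misI /= -leNgt => nuI.
    rewrite powE ler_expR lerN2 nu_setT ler_wpM2l //; last by rewrite mulrA.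
    by rewrite oppr_ge0 ln_le0 //; lra.
  by move=> I; apply: exprn_ge0; lra.
have upper := wt_setT_le (@Badj_sym d) (Badj_tri d_gt0) (Badj_regular d_gt0)
  (card_Bvertex d_gt0) d_gt0 dleN l_ge1.
(* N <= 2m and (7/5)^2 = 2b turn this power into (2b)^m; its b^m cancels against the weight
   threshold, leaving 2^m b^(2hm). *)
have pow2 : (7 / 5 : R) ^+ N <= expR (m%:R * (ln 2 - beta)).
  apply: (@le_trans _ _ ((7 / 5) ^+ (2 * m))).
    by apply: ler_weXn2l => //; lra.
  rewrite exprM expRM_natl opprK expRD !lnK ?posrE //.
  by have -> : (7 / 5) ^+ 2 = 2 * (49 / 50) :> R by field.
have expN : expR (2 * ln (d.+1%:R : R) ^+ 2 * (N%:R / d%:R))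
    <= expR (m%:R * (4 * ln (d.+1%:R : R) ^+ 2 / d%:R)).
  rewrite ler_expR; set l2 := ln _ ^+ 2.
  have l20 : 0 <= l2 / d%:R by rewrite divr_ge0 ?sqr_ge0 // ltW.
  have NR : N%:R <= 2 * m%:R :> R by rewrite -natrM ler_nat.
  have -> : 2 * l2 * (N%:R / d%:R) = 2 * (l2 / d%:R) * N%:R by ring.
  have -> : m%:R * (4 * l2 / d%:R) = 2 * (l2 / d%:R) * (2 * m%:R) by ring.
  by rewrite ler_wpM2l // mulr_ge0.
rewrite -(ler_pM2r (expR_gt0 (- (beta * ((1 - 2 * h) * m%:R))))) -expRD.
apply: le_trans lower (le_trans upper _).
apply: le_trans (ler_pM _ _ pow2 expN) _; rewrite ?expR_ge0 ?exprn_ge0 //.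
  by lra.
rewrite -expRD ler_expR; set q := 4 * _ / _; set b := beta; set h' := h.
by lra.
Qed.

Lemma small_matching_gt0 : (1 < d)%N -> 2 * h <= 1 ->
  (0 < #|Bmis d :\: J1 R d|)%N.
Proof.
move=> d1 h1; apply/card_gt0P; exists (low_layer d).
rewrite inE (low_layer_Bmis d_gt0) andbT inE (low_layer_Bmis d_gt0) /=.
rewrite low_layer_matching // cards0 -leNgt mulr_ge0 //.
by lra.
Qed.

End Counting.

(** * Explicit estimates for large d *)

Section Asymptotics.

Local Open Scope ring_scope.

Variables (R : realType) (d : nat).

Local Notation m := 'C(2 * d - 2, d - 1).
Local Notation h := (log2 (d%:R : R) ^+ 3 / d%:R).
Local Notation beta := (- ln (49 / 50 : R)).

Lemma beta_gt0 : 0 < beta.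
Proof. by rewrite oppr_gt0 ln_lt0 //; lra. Qed.

Lemma ln_two_gt0 : 0 < ln (2 : R).
Proof. by rewrite ln_gt0 //; lra. Qed.

Lemma ln_two_le1 : ln (2 : R) <= 1.
Proof. by rewrite (_ : 2 = 1 + 1) // le_ln1Dx //; lra. Qed.

Hypothesis ln_d_ge1 : 1 <= ln (d%:R : R).
Hypothesis ln_d_ge_beta : 16 / beta <= ln (d%:R : R).
Hypothesis ln_d_ge_ln2 : 48 / ln 2 ^+ 3 <= ln (d%:R : R).

Local Notation L := (ln (d%:R : R)).

Lemma ln_ge1_gt1 : (1 < d)%N.
Proof.
have L1 := ln_d_ge1; case: d L1 => [|[|//]].
  by rewrite ln0 //; lra.
by rewrite ln1; lra.
Qed.

Lemma expR_ln_nat : expR L = d%:R.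
Proof. by rewrite lnK // posrE ltr0n; have := ln_ge1_gt1; case: d. Qed.

Lemma ln_le_log2 : L <= log2 (d%:R : R).
Proof.
have L1 := ln_d_ge1; rewrite /log2 ler_pdivlMr ?ln_two_gt0 //.
by rewrite ler_piMr ?ln_two_le1 //; lra.
Qed.

(** Uses e^L >= 1 + L^4/24 for L = ln d; the constant 48 = 2 * 24 in the hypothesis makes L^4/24 at
    least 2 log2(d)^3. *)
Lemma double_log2_cube_le : 2 * h <= 1.
Proof.
have L1 := ln_d_ge1; have d0 : 0 < d%:R :> R by rewrite -expR_ln_nat expR_gt0.
have L0 : 0 <= L by lra.
rewrite mulrA ler_pdivrMr // mul1r -{2}expR_ln_nat.
apply: le_trans (expR_ge1Dxn 3 L0).
have -> : (4`!)%:R = 24 :> R by [].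
have ln20 : 0 < ln (2 : R) ^+ 3 by rewrite exprn_gt0 ?ln_two_gt0.
have H : 48 <= L * ln 2 ^+ 3 by rewrite -ler_pdivrMr.
rewrite /log2 expr_div_n mulrA ler_pdivrMr //.
have L30 : 0 <= L ^+ 3 by rewrite exprn_ge0.
have := ler_wpM2l L30 H; rewrite mulrA -exprSr => H1.
by rewrite mulrDl mul1r mulrAC; lra.
Qed.

(** Makes hm tend to infinity, which the little-o statement needs; by d <= m it reduces to comparing
    L with log2(d)^3. *)
Lemma ln_le_log2_cube_bin : L <= h * m%:R.
Proof.
have d0 : 0 < d%:R :> R by rewrite -expR_ln_nat expR_gt0.
have L1 := ln_d_ge1; have L2 := ln_le_log2.
have dm : d%:R <= m%:R :> R by rewrite ler_nat leq_bin_middle // ltnW // ln_ge1_gt1.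
have l1 : 1 <= log2 (d%:R : R) by lra.
have l3 : log2 (d%:R : R) <= log2 (d%:R : R) ^+ 3 by rewrite ler_eXnr.
have h0 : 0 <= h by rewrite divr_ge0 ?exprn_ge0 //; lra.
apply: (@le_trans _ _ (h * d%:R)); last exact: ler_wpM2l.
rewrite mulrVK ?unitfE ?gt_eqF //.
by lra.
Qed.

(** As d + 1 <= d^2, the error 4 ln(d + 1)^2 / d is at most 16 L^2 / d, and L >= 16/beta makes this
    at most beta h: half of the gain 2 beta h is spent. *)
Lemma small_matching_le_log2 :
  #|Bmis d :\: J1 R d|%:R <= expR (m%:R * (ln 2 - beta * h)).
Proof.
have L1 := ln_d_ge1; have L2 := ln_le_log2; have b0 := beta_gt0.
have d0 : 0 < d%:R :> R by rewrite -expR_ln_nat expR_gt0.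
have Ll : L <= ln d.+1%:R.
  by rewrite ler_ln ?posrE ?ltr0n ?ler_nat // ltnW // ln_ge1_gt1.
have lL : ln (d.+1%:R : R) <= 2 * L.
  rewrite mulr_natl -lnXn // ler_ln ?posrE ?exprn_gt0 ?ltr0n ?(ltnW ln_ge1_gt1) //.
  have := leq_mul ln_ge1_gt1 (leqnn d).
  by rewrite -natrX ler_nat -mulnn; move: ln_ge1_gt1; clear; lia.
apply: le_trans (small_matching_le (ltnW ln_ge1_gt1) (le_trans L1 Ll)) _.
rewrite ler_expR ler_wpM2l //.
suff : 4 * ln (d.+1%:R : R) ^+ 2 / d%:R <= beta * h by lra.
rewrite [leRHS]mulrA ler_pM2r ?invr_gt0 //.
have H16 : 16 <= beta * L by rewrite mulrC -ler_pdivrMr.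
have sq : ln (d.+1%:R : R) ^+ 2 <= 4 * L ^+ 2.
  have -> : 4 * L ^+ 2 = (2 * L) ^+ 2 by ring.
  by rewrite ler_pXn2r ?nnegrE //; lra.
have cube : L ^+ 3 <= log2 (d%:R : R) ^+ 3 by rewrite ler_pXn2r ?nnegrE //; lra.
have L20 : 0 <= L ^+ 2 by rewrite sqr_ge0.
have := ler_wpM2r L20 H16; rewrite -mulrA -exprS => H1.
have := ler_wpM2l (ltW b0) cube.
by lra.
Qed.

End Asymptotics.

(* Passage to the limit *)
From mathcomp Require Import all_classical all_reals all_analysis.

Import numFieldNormedType.Exports.

Local Open Scope classical_set_scope.
Local Open Scope ring_scope.

Lemma near_ln_ge (R : realType) (K : R) : \forall d \near \oo, K <= ln d%:R.
Proof.
apply: filterS (nbhs_infty_ger (expR K)) => d Kd.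
have d0 : 0 < d%:R :> R by apply: lt_le_trans Kd; apply: expR_gt0.
by rewrite -ler_expR lnK.
Qed.

Theorem theorem2p6 (R : realType) :
  (exists2 g : nat -> R,
      is_Omega g (fun d => log2 (d%:R : R) ^+ 3 / d%:R)
    & \forall d \near \oo,
        #|(Bmis d :\: J1 R d)%SET|%:R
          = (2 : R) `^ ((1 - g d) * 'C(2 * d - 2, d - 1)%:R)) /\
  (fun d : nat => #|(Bmis d :\: J1 R d)%SET|%:R : R^o)
    =o_\oo (fun d : nat => #|Bmis d|%:R : R^o).
Proof.
have b0 := beta_gt0 R; have ln20 := ln_two_gt0 R.
pose S d : R := #|(Bmis d :\: J1 R d)%SET|%:R.
pose m d : R := 'C(2 * d - 2, d - 1)%:R.
pose K : R := Num.max 1 (Num.max (16 / - ln (49 / 50)) (48 / ln 2 ^+ 3)).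
have nearK : \forall d \near \oo, K <= ln (d%:R : R) by apply: near_ln_ge.
have ev d : K <= ln (d%:R : R) ->
    [/\ (0 < d)%N, 0 < S d, 0 < m d,
      S d <= expR (m d * (ln 2 - - ln (49 / 50) * (log2 (d%:R : R) ^+ 3 / d%:R)))
    & ln (d%:R : R) <= log2 (d%:R : R) ^+ 3 / d%:R * m d].
  rewrite !ge_max => /and3P [K1 K2 K3]; have d1 := ln_ge1_gt1 K1.
  have d0 := ltnW d1; split => //.
  - by rewrite ltr0n small_matching_gt0 // double_log2_cube_le.
  - by rewrite ltr0n; apply: leq_trans (leq_bin_middle d0).
  - exact: small_matching_le_log2.
  - exact: ln_le_log2_cube_bin.
split.
  (* [g] is solved from the required identity; [S d] and [m d] are positive for large [d]. *)
  exists (fun d => 1 - ln (S d) / ln 2 / m d).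
    exists (- ln (49 / 50) / ln 2); first by rewrite divr_gt0.
    apply: filterS nearK => d /ev [d0 S0 m0 Sle _].
    move: Sle; set h := log2 _ ^+ 3 / _ => Sle.
    have lnS : ln (S d) <= m d * (ln 2 - - ln (49 / 50) * h).
      by rewrite -ler_expR lnK.
    rewrite lerBrDr -lerBrDl ler_pdivrMr // ler_pdivrMr //.
    have -> : (1 - - ln (49 / 50) / ln 2 * h) * m d * ln 2
              = m d * (ln 2 - - ln (49 / 50) * h).
      by field; rewrite gt_eqF.
    exact: lnS.
  apply: filterS nearK => d /ev [d0 S0 m0 _ _].
  rewrite -/(S d) -/(m d) opprB addrC subrK mulfVK ?gt_eqF //.
  by rewrite /powR pnatr_eq0 /= mulfVK ?gt_eqF // lnK.
apply/eqoP => eps eps0.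
(* This bound on ln d, with ln d <= hm, gives exp(-beta h m) <= eps; the remaining factor 2^m is at
   most the size of [Bmis d]. *)
apply: filterS2 nearK (near_ln_ge (- ln eps / - ln (49 / 50))) => d /ev.
case=> d0 S0 m0 Sle hm Keps; rewrite !normr_nat -/(S d).
apply: le_trans Sle _; rewrite mulrBr expRD mulrC.
apply: ler_pM; rewrite ?expR_ge0 //.
  rewrite -[eps]lnK ?posrE // ler_expR lerNl.
  have := le_trans Keps hm; rewrite ler_pdivrMr // => H.
  by apply: le_trans H _; rewrite le_eqVlt; apply/orP; left; apply/eqP; ring.
rewrite expRM_natl lnK ?posrE // -natrX ler_nat.
exact: card_Bmis_ge.
Qed.
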